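(* Let $K$ be a field of characteristic $p\ge 0$ with algebraic closure $\overline{K}$, let $f_1,f_2\in K[x]\setminus K[x^p]$, and let $d\ge 1$ be an integer. Suppose $c_1,\dots,c_{2d}\in\overline{K}$ satisfy $f_1(c_i)=f_1(c_{i+1})$ for odd $i$ and $f_2(c_i)=f_2(c_{i+1})$ for even $i$ (where $1\le i\le 2d$ and $c_{2d+1}:=c_1$). Suppose further that $[K(c_1):K]$ is divisible by a prime greater than $\max(\deg(f_1),\deg(f_2))$. If $$\prod_{i=1}^d\bigl(f_1'(c_{2i-1})f_2'(c_{2i})\bigr)\ne\prod_{i=1}^d\bigl(f_2'(c_{2i-1})f_1'(c_{2i})\bigr),$$ then $f_1$ and $f_2$ have no common composite.
   Context: Nonconstant polynomials $f_1,f_2\in K[x]$ have a common composite (over $K$) if there are nonconstant $u,v\in K[x]$ such that $u(f_1(x))=v(f_2(x))$. When $p=0$, $K[x^p]$ means $K$; in every characteristic, $f\in K[x]\setminus K[x^p]$ means that the derivative $f'$ is nonzero. *)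

(* Defs.v *)
From HB Require Import structures.
From mathcomp Require Import all_boot all_order all_algebra all_field.

Set Implicit Arguments.
Unset Strict Implicit.
Unset Printing Implicit Defensive.

Import GRing.Theory.
Local Open Scope ring_scope.

Definition has_char (K : fieldType) (p : nat) : Prop :=
  if p is 0 then [pchar K] =i pred0 else p \in [pchar K].

(* f lies in K[x^p]. For p = 0 this says that f lies in K, because 'X^0 = 1
   and g \Po 1 = (g.[1])%:P. *)
Definition poly_in_Xp (K : fieldType) (p : nat) (f : {poly K}) : Prop :=
  exists g : {poly K}, f = g \Po 'X^p.

Definition is_algebraic_closure (K : fieldType) (L : closedFieldType)
    (iota : {rmorphism K -> L}) : Prop :=
  forall x : L, algebraicOver iota x.

Definition eval_in (K L : fieldType) (iota : {rmorphism K -> L})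
    (f : {poly K}) (x : L) : L := (map_poly iota f).[x].

(* [K(c) : K] = n, for c in a (possibly infinite) extension iota : K -> L.
   MathComp's theory of degrees lives in finite extensions, so the degree is
   computed in a finite extension E of K, embedded in L over K by phi, that
   contains c; the value does not depend on E, phi and z. *)
Definition ext_degree (K L : fieldType) (iota : {rmorphism K -> L})
    (c : L) (n : nat) : Prop :=
  exists (E : fieldExtType K) (phi : {rmorphism E -> L}) (z : E),
    [/\ forall a : K, phi a%:A = iota a, phi z = c & \dim <<1; z>>%VS = n].

Definition common_composite (K : fieldType) (f1 f2 : {poly K}) : Prop :=
  exists u v : {poly K},
    [/\ (1 < size u)%N, (1 < size v)%N & u \Po f1 = v \Po f2].

(* Main.v *)
Require Import Defs.
From HB Require Import structures.
From mathcomp Require Import all_boot all_order all_algebra all_field.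
From mathcomp Require Import ring.
From mathcomp Require boolp.

Set Implicit Arguments.
Unset Strict Implicit.
Unset Printing Implicit Defensive.

Import GRing.Theory.
Local Open Scope ring_scope.

(** Say that f1 and f2 have a composite h = u o f1 = v o f2. By the chain rule,
    u'(f1(x)) f1'(x) = v'(f2(x)) f2'(x) for all x. The factor u'(f1(x)) is the
    same at both ends of an f1-link, and v'(f2(x)) at both ends of an f2-link.
    Going along the chain, one therefore finds that the two products of the
    theorem agree after multiplication by v'(f2(c_1)), which is the value both
    at the start and at the end of the cycle (prod_alternating_chain). They
    are equal if h'(c_1) is nonzero, since then v'(f2(c_1)) is. The difficulty
    is that h may be ramified at c_1, and that in positive characteristic h'
    may even be the zero polynomial.

    The remedy is to replace h by a composite over the algebraic closure that
    is unramified at c_1. Let q be the large prime, and let S be the set of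
    the x with h(x) = h(c_1) and with [K(x) : K] divisible by q. It is finite,
    as h is nonconstant, and it contains c_1. It is closed under passing from
    x to a y with f1(y) = f1(x) =: t: the prime q divides [K(x) : K] but
    exceeds [K(x) : K(t)], so it divides [K(t) : K] and hence [K(y) : K]
    (dvd_ext_degree_fiber). Moreover f1' has no zero in S, because f1' is not
    the zero polynomial, so that each of its zeros has degree less than
    deg f1 < q over K. Hence S is a disjoint union of fibers of f1, each
    consisting of deg f1 distinct points, and g = prod_(s in S) (x - s) is, up
    to a constant, the product of the f1 - t for t in f1(S), which is a
    polynomial in f1 (prod_fiber_closed). The same goes for f2. So g is a
    composite of f1 and f2 with a simple zero at c_1
    (separable_common_composite), and the first paragraph applies to it. *)

Lemma deriv_neq0_of_notin_Xp (K : fieldType) (p : nat) (f : {poly K}) :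
  has_char K p -> ~ poly_in_Xp p f -> f^`() != 0.
Proof.
move=> hp nfp; apply/eqP => f'0; apply: nfp.
have f'i i : f`_i.+1 * i.+1%:R = 0.
  by rewrite mulr_natr -coef_deriv f'0 coef0.
case: p hp => [|p] /= charK.
  exists (f`_0)%:P; rewrite comp_polyC; apply/polyP => -[|i]; rewrite coefC //=.
  have /eqP := f'i i; rewrite mulf_eq0.
  by rewrite ((pcharf0P K).1 charK) orbF => /eqP.
exists (\poly_(i < size f) f`_(i * p.+1)); apply/polyP => i.
rewrite coef_comp_poly_Xn // coef_poly; case: ifP => [/divnK {1}<-|pNi].
  case: ltnP => // /(leq_trans) le_i; rewrite nth_default //.
  by apply: le_i; rewrite leq_pmulr.
case: i pNi => [|i pNi]; first by rewrite dvdn0.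
have /eqP := f'i i; rewrite mulf_eq0.
by rewrite -(dvdn_pcharf charK) pNi orbF => /eqP.
Qed.

(** * Degrees of algebraic elements *)

Section Degree.

Variables (K : fieldType) (L : closedFieldType) (iota : {rmorphism K -> L}).

(** The degree is that of the minimal polynomial of c, whatever the extension
    in which it was computed. *)
Lemma ext_degree_minP (c : L) (n : nat) : ext_degree iota c n ->
  (exists2 P : {poly K}, size P = n.+1 & root (map_poly iota P) c)
  /\ (forall Q : {poly K}, Q != 0 -> root (map_poly iota Q) c ->
        (n < size Q)%N).
Proof.
case=> E [phi [z [phiK phiz <-]]].
have mapE Q : map_poly iota Q = map_poly phi (map_poly (in_alg E) Q).
  by rewrite -map_poly_comp; apply: eq_map_poly => a /=.
have dimE : size (minPoly 1 z) = (\dim <<1; z>>).+1.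
  by rewrite size_minPoly dim_Fadjoin dimv1 muln1.
split=> [|Q Q0].
  have /polyOver1P[P eP] := minPolyOver 1 z; exists P.
    by rewrite -dimE eP size_map_poly.
  by rewrite mapE -eP -phiz fmorph_root root_minPoly.
rewrite mapE -phiz fmorph_root => rQ; rewrite -dimE -(size_map_poly (in_alg E)).
by apply: dvdp_leq; rewrite ?map_poly_eq0 ?minPoly_dvdp // alg_polyOver.
Qed.

Lemma ext_degree_inj (c : L) (m n : nat) :
  ext_degree iota c m -> ext_degree iota c n -> m = n.
Proof.
suff le m' n' : ext_degree iota c m' -> ext_degree iota c n' -> (m' <= n')%N.
  by move=> cm cn; apply/eqP; rewrite eqn_leq !le.
move=> /ext_degree_minP[_ min_m] /ext_degree_minP[[P szP rP] _].
by rewrite -ltnS -szP min_m // -size_poly_gt0 szP.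
Qed.

(** A polynomial over K of least degree with c as a root is irreducible, and so
    defines a copy of K(c). *)
Lemma ext_degree_exists (c : L) :
  algebraicOver iota c -> exists n, ext_degree iota c n.
Proof.
case=> P0 nzP0 rP0.
pose has_size n := boolp.asbool
  (exists P : {poly K}, [/\ P != 0, root (map_poly iota P) c & size P = n]).
have ex_size : exists n, has_size n.
  by exists (size P0); apply/boolp.asboolP; exists P0.
case: (ex_minnP ex_size) => n /boolp.asboolP[P [nzP rP szP]] minP.
have irrP : irreducible_poly P.
  apply/(subfx_irreducibleP rP nzP) => Q rQ nzQ; rewrite szP.
  by apply: minP; apply/boolp.asboolP; exists Q.
pose E := SubFieldExtType rP irrP.
exists (\dim <<1; (subfx_root iota c P : E)>>), E, (@subfx_inj K L iota c P).
exists (subfx_root iota c P); split=> // [a|].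
- exact: subfx_inj_base.
- exact: subfx_inj_root.
Qed.

(** This is the tower K, K(f(c)), K(c): the element c is a root of the
    polynomial f - f(c) over the middle field. *)
Lemma ext_degree_eval (f : {poly K}) (c : L) (n : nat) :
    (1 < size f)%N -> ext_degree iota c n ->
  exists r m : nat, [/\ ext_degree iota (eval_in iota f c) m, n = (r * m)%N
                      & (0 < r < size f)%N].
Proof.
move=> f_gt1 [E [phi [z [phiK phiz dimE]]]].
pose fE := map_poly (in_alg E) f; pose t := fE.[z].
have Kz_t : t \in <<1; z>>%VS by apply/Fadjoin1_polyP; exists f.
exists (adjoin_degree <<1; t>> z), (\dim <<1; t>>); split.
- exists E, phi, t; split=> //; rewrite /eval_in -phiz -horner_map /= -/fE.
  by rewrite -map_poly_comp; congr _.[_]; apply: eq_map_poly => a /=.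
- rewrite -dim_Fadjoin -dimE; congr (\dim _); apply/eqP.
  rewrite eqEsubv; apply/andP; split; apply/FadjoinP; split.
  + exact: sub1v.
  + exact: memv_adjoin.
  + by apply/FadjoinP; split; rewrite ?sub1v.
  + exact: memv_adjoin.
- rewrite lt0n; apply/andP; split; first by [].
  have szft : size (fE - t%:P) = size f.
    rewrite size_polyDl size_map_poly // size_polyN.
    by apply: leq_ltn_trans f_gt1; rewrite size_polyC leq_b1.
  rewrite -szft -size_minPoly; apply: dvdp_leq.
    by rewrite -size_poly_gt0 szft ltnW.
  apply: minPoly_dvdp; last by rewrite rootE !hornerE subrr.
  rewrite rpredB ?polyOverC ?memv_adjoin //.
  by apply: (polyOverSv (sub1v _)); exact: alg_polyOver.
Qed.

(** Divisibility of the degree by q, unlike a mere lower bound on the degree,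
    passes from one point to another along the fibers of a polynomial. *)
Definition dvd_ext_degree (q : nat) (x : L) : Prop :=
  exists2 n, ext_degree iota x n & (q %| n)%N.

(** Both [K(x) : K] and [K(y) : K] are multiples of the degree of the common
    value f(x) = f(y), and the cofactor for x is too small to be divisible by
    the prime q. *)
Lemma dvd_ext_degree_fiber (f : {poly K}) (q : nat) (x y : L) :
    is_algebraic_closure iota -> (1 < size f)%N ->
    prime q -> ((size f).-1 < q)%N ->
    eval_in iota f y = eval_in iota f x ->
  dvd_ext_degree q x -> dvd_ext_degree q y.
Proof.
move=> algL f_gt1 q_pr f_q eq_f [n deg_x q_n].
have [m deg_y] := ext_degree_exists (algL y); exists m => //.
have [r [k [deg_fx en /andP[r_gt0 r_f]]]] := ext_degree_eval f_gt1 deg_x.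
have [r' [k' [deg_fy -> _]]] := ext_degree_eval f_gt1 deg_y.
rewrite eq_f in deg_fy; rewrite (ext_degree_inj deg_fy deg_fx) dvdn_mull //.
move: q_n; rewrite en Euclid_dvdM // => /orP[/(dvdn_leq r_gt0)|//].
rewrite leqNgt (leq_ltn_trans _ f_q) //.
by rewrite -ltnS (leq_trans r_f) // leqSpred.
Qed.

Lemma dvd_ext_degree_deriv_neq0 (f : {poly K}) (q : nat) (x : L) :
    f^`() != 0 -> ((size f).-1 < q)%N -> dvd_ext_degree q x ->
  (map_poly iota f)^`().[x] != 0.
Proof.
move=> f'0 f_q [n /ext_degree_minP[[P szP rP] min_n] q_n].
have n_gt0 : (0 < n)%N.
  rewrite -ltnS -szP -(size_map_poly iota) (root_size_gt1 _ rP) //.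
  by rewrite map_poly_eq0 -size_poly_gt0 szP.
rewrite deriv_map; apply/negP => /(min_n _ f'0).
rewrite ltnNge => /negP; apply; apply: leq_trans (dvdn_leq n_gt0 q_n).
apply: leq_trans (leq_trans (leqSpred _) f_q); apply/ltnW/lt_size_deriv.
by apply: contraNneq f'0 => ->; rewrite deriv0.
Qed.

End Degree.

(** * Polynomials whose composites have simple zeros *)

Lemma separable_closedP (L : closedFieldType) (w : {poly L}) :
  reflect (forall x, root w x -> w^`().[x] != 0) (separable_poly w).
Proof. by rewrite separable_poly.unlock; apply: Pdiv.ClosedField.coprimepP. Qed.

(** The set s is a disjoint union of fibers of F. Each of the polynomials F - t,
    for t in F(s), has its whole fiber as zeros, and they are simple because F'
    does not vanish on s. So the product of the F - t, a polynomial in F, is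
    the left-hand side up to its leading coefficient. *)
Lemma prod_fiber_closed (L : closedFieldType) (F : {poly L}) (s : seq L) :
    uniq s ->
    (forall x y, x \in s -> F.[y] = F.[x] -> y \in s) ->
    (forall x, x \in s -> F^`().[x] != 0) ->
  exists U : {poly L}, \prod_(x <- s) ('X - x%:P) = U \Po F.
Proof.
move=> uniq_s fibF F'neq0.
pose w := \prod_(t <- undup (map (horner F) s)) ('X - t%:P).
pose G := w \Po F.
have rootG x : root G x = (x \in s).
  rewrite rootE horner_comp -rootE root_prod_XsubC mem_undup.
  apply/mapP/idP => [[y sy eFxy]|sx]; last by exists x.
  exact: fibF sy eFxy.
have sepG : separable_poly G.
  have : separable_poly w by rewrite separable_prod_XsubC undup_uniq.
  move=> /separable_closedP sep_w.
  apply/separable_closedP => x rGx.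
  rewrite deriv_comp hornerM horner_comp mulf_neq0 //.
    by apply: sep_w; rewrite rootE -horner_comp.
  by rewrite F'neq0 // -rootG.
have [r eG] := closed_field_poly_normal G.
have lG : lead_coef G != 0 by rewrite lead_coef_eq0 separable_poly_neq0.
have uniq_r : uniq r.
  by rewrite -separable_prod_XsubC -(eqp_separable (eqp_scale _ lG)) -eG.
have r_s : perm_eq r s.
  apply: uniq_perm => // x.
  by rewrite -rootG eG rootZ // root_prod_XsubC.
exists ((lead_coef G)^-1 *: w).
apply: (scalerI lG).
by rewrite comp_polyZ scalerA divff // scale1r -(perm_big _ r_s) /= -eG.
Qed.

(** The given composite h, which may be ramified at x0, only serves to make
    finite the set of the points of P that have the same h-value as x0. The
    product of the x - s over this set is the composite sought. *)
Lemma separable_common_composite (L : closedFieldType) (F1 F2 u v : {poly L})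
    (P : L -> Prop) (x0 : L) :
    (1 < size (u \Po F1))%N -> u \Po F1 = v \Po F2 ->
    (forall x y, P x -> F1.[y] = F1.[x] -> P y) ->
    (forall x y, P x -> F2.[y] = F2.[x] -> P y) ->
    (forall x, P x -> F1^`().[x] != 0) ->
    (forall x, P x -> F2^`().[x] != 0) ->
    P x0 ->
  exists U V : {poly L}, U \Po F1 = V \Po F2 /\ (U \Po F1)^`().[x0] != 0.
Proof.
set h := u \Po F1 => h_gt1 hF2 fib1 fib2 der1 der2 Px0.
pose H := h - h.[x0]%:P.
have lH : lead_coef H != 0.
  rewrite lead_coef_eq0 -size_poly_gt0 size_polyDl ?(ltnW h_gt1) //.
  rewrite size_polyN size_polyC; exact: leq_ltn_trans (leq_b1 _) h_gt1.
have [r eH] := closed_field_poly_normal H.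
pose S := undup [seq x <- r | boolp.asbool (P x)].
have memS x : x \in S <-> h.[x] = h.[x0] /\ P x.
  rewrite mem_undup mem_filter; have -> : (x \in r) = (h.[x] == h.[x0]).
    by rewrite -root_prod_XsubC -(rootZ _ _ lH) -eH rootE !hornerE subr_eq0.
  split=> [/andP[/boolp.asboolP Px /eqP] | [/eqP -> Px]] //.
  by rewrite andbT; apply/boolp.asboolP.
have uniqS : uniq S by exact: undup_uniq.
have S_fib1 x y : x \in S -> F1.[y] = F1.[x] -> y \in S.
  move=> /memS[hx Px] e; apply/memS; split; last exact: fib1 Px e.
  by rewrite -hx !horner_comp e.
have S_fib2 x y : x \in S -> F2.[y] = F2.[x] -> y \in S.
  move=> /memS[hx Px] e; apply/memS; split; last exact: fib2 Px e.
  by rewrite -hx hF2 !horner_comp e.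
have [U eU] : exists U, \prod_(x <- S) ('X - x%:P) = U \Po F1.
  by apply: prod_fiber_closed => // x /memS[_]; apply: der1.
have [V eV] : exists V, \prod_(x <- S) ('X - x%:P) = V \Po F2.
  by apply: prod_fiber_closed => // x /memS[_]; apply: der2.
exists U, V; rewrite -eU -eV; split=> //.
have /separable_closedP : separable_poly (\prod_(x <- S) ('X - x%:P)).
  by rewrite separable_prod_XsubC.
by apply; rewrite root_prod_XsubC; apply/memS.
Qed.

(** * Going around the cycle *)

(** Multiplying by a and b turns the ratio of f to g at a point into that of b
    to a. As a is constant along the odd links and b along the even ones, the
    product of the ratios telescopes to the quotient of the values of b at the
    two ends. *)
Lemma prod_alternating_chain (R : comNzRingType) (T : Type) (c : nat -> T)
    (a b f g : T -> R) (n : nat) :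
    (forall x, a x * f x = b x * g x) ->
    (forall i, (1 <= i <= n)%N -> a (c (2 * i - 1)%N) = a (c (2 * i)%N)) ->
    (forall i, (1 <= i <= n)%N -> b (c (2 * i)%N) = b (c (2 * i + 1)%N)) ->
  \prod_(1 <= i < n.+1) (f (c (2 * i - 1)%N) * g (c (2 * i)%N))
    * b (c (2 * n + 1)%N)
  = \prod_(1 <= i < n.+1) (g (c (2 * i - 1)%N) * f (c (2 * i)%N)) * b (c 1%N).
Proof.
move=> afbg; elim: n => [|n IH] a_odd b_even; first by rewrite !big_nil.
have {}IH : \prod_(1 <= i < n.+1) (f (c (2 * i - 1)%N) * g (c (2 * i)%N))
    * b (c (2 * n + 1)%N)
  = \prod_(1 <= i < n.+1) (g (c (2 * i - 1)%N) * f (c (2 * i)%N)) * b (c 1%N).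
  by apply: IH => i /andP[i_gt0 /leqW le_in]; rewrite (a_odd, b_even) ?i_gt0.
rewrite !(@big_nat_recr _ _ _ n.+1) //=.
have := b_even n.+1; rewrite leqnn /= => <- //.
have := a_odd n.+1; rewrite leqnn /= => /(_ isT).
have -> : (2 * n.+1 - 1 = 2 * n + 1)%N by rewrite mulnS addnC -addnBA.
move: IH; move: (c (2 * n + 1)%N) (c (2 * n.+1)%N) => x y.
move: (\prod_(1 <= i < n.+1) _) (\prod_(1 <= i < n.+1) _) => Q P IH a_xy.
transitivity (P * f x * (b y * g y)); first by ring.
rewrite -afbg -a_xy; transitivity (P * (a x * f x) * f y); first by ring.
by rewrite afbg mulrA IH; ring.
Qed.

Theorem theorem9p6 (K : fieldType) (p : nat) (hp : has_char K p)
    (Kbar : closedFieldType) (iota : {rmorphism K -> Kbar})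
    (hKbar : is_algebraic_closure iota)
    (f1 f2 : {poly K}) (hf1 : ~ poly_in_Xp p f1) (hf2 : ~ poly_in_Xp p f2)
    (d : nat) (hd : (1 <= d)%N)
    (c : nat -> Kbar) (* only c 1, ..., c (2 * d + 1) matter *)
    (hcyc : c (2 * d + 1)%N = c 1%N)
    (hodd : forall i : nat, (1 <= i <= 2 * d)%N -> odd i ->
      eval_in iota f1 (c i) = eval_in iota f1 (c i.+1))
    (heven : forall i : nat, (1 <= i <= 2 * d)%N -> ~~ odd i ->
      eval_in iota f2 (c i) = eval_in iota f2 (c i.+1))
    (hdeg : exists n q : nat,
      [/\ ext_degree iota (c 1%N) n, prime q, (q %| n)%N
        & (maxn (size f1).-1 (size f2).-1 < q)%N])
    (hprod :
      \prod_(1 <= i < d.+1) (eval_in iota f1^`() (c (2 * i - 1)%N)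
                             * eval_in iota f2^`() (c (2 * i)%N))
      <> \prod_(1 <= i < d.+1) (eval_in iota f2^`() (c (2 * i - 1)%N)
                             * eval_in iota f1^`() (c (2 * i)%N))) :
  ~ common_composite f1 f2.
Proof.
case=> u [v [u_gt1 v_gt1 eq_uv]].
have [n [q [deg_c1 q_pr q_n lt_q]]] := hdeg.
have {lt_q} [lt1 lt2] : ((size f1).-1 < q)%N /\ ((size f2).-1 < q)%N.
  by apply/andP; rewrite -gtn_max.
have f1'0 := deriv_neq0_of_notin_Xp hp hf1.
have f2'0 := deriv_neq0_of_notin_Xp hp hf2.
have size_gt1 (f : {poly K}) : f^`() != 0 -> (1 < size f)%N.
  rewrite ltnNge; apply: contra => /size1_polyC ->.
  by rewrite derivC.
pose F1 := map_poly iota f1; pose F2 := map_poly iota f2.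
pose D := dvd_ext_degree iota q.
have fib1 x y : D x -> F1.[y] = F1.[x] -> D y.
  by move=> Dx e; apply: dvd_ext_degree_fiber e Dx => //; apply: size_gt1.
have fib2 x y : D x -> F2.[y] = F2.[x] -> D y.
  by move=> Dx e; apply: dvd_ext_degree_fiber e Dx => //; apply: size_gt1.
have D1 : D (c 1%N) by exists n.
have [U [V [eUV g'c1]]] : exists U V : {poly Kbar},
    U \Po F1 = V \Po F2 /\ (U \Po F1)^`().[c 1%N] != 0.
  apply: (@separable_common_composite _ F1 F2 (map_poly iota u)
    (map_poly iota v) D) => //.
  - rewrite -map_comp_poly size_map_poly -ltn_predRL size_comp_poly muln_gt0.
    by rewrite !ltn_predRL u_gt1 size_gt1.
  - by rewrite -!map_comp_poly eq_uv.
  - by move=> x; apply: dvd_ext_degree_deriv_neq0.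
  - by move=> x; apply: dvd_ext_degree_deriv_neq0.
pose a x := (U^`() \Po F1).[x]; pose b x := (V^`() \Po F2).[x].
have ab x : a x * F1^`().[x] = b x * F2^`().[x].
  by rewrite /a /b -!hornerM -!deriv_comp eUV.
have b1 : b (c 1%N) != 0.
  by move: g'c1; rewrite eUV deriv_comp hornerM mulf_eq0 negb_or => /andP[].
apply: hprod; apply: (mulIf b1); rewrite -[in LHS]hcyc.
have := prod_alternating_chain (c := c) (n := d) ab.
rewrite /eval_in -!deriv_map; apply => i /andP[i_gt0 le_id].
- rewrite /a !horner_comp; congr _.[_].
  case: i i_gt0 le_id => // i _ lt_id; rewrite mulnS add2n subn1 /=.
  by apply: hodd; rewrite /= ?ltn_pmul2l ?oddM.
- rewrite /b !horner_comp addn1; congr _.[_]; apply: heven; rewrite ?oddM //.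
  by rewrite muln_gt0 i_gt0 leq_mul2l le_id.
Qed.
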